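(* Let $\mathcal{H}=\mathcal{H}(X)$ be a reproducing kernel Hilbert space, let $A\in\mathscr{B}(\mathcal{H})$ and let $p,q\ge1$ be such that $\frac1p+\frac1q=1$. Then for $r\ge2$ and $\zeta\ge0$, $$ \begin{aligned} \mathrm{ber}^{2r}(A)\le{}&\frac{2\zeta+1}{2\zeta+2}\Bigg(\frac{\||A|^{pr}\|_{\mathrm{ber}}}{p^2}+\frac{\||A^*|^{qr}\|_{\mathrm{ber}}}{q^2}\\ &\quad+\frac{\||A|^{2p(r-1)}\|_{\mathrm{ber}}^{1/2}\,\||A^*|^{2q}\|_{\mathrm{ber}}^{1/2}+\||A|^{2p}\|_{\mathrm{ber}}^{1/2}\,\||A^*|^{2q(r-1)}\|_{\mathrm{ber}}^{1/2}}{pq}\Bigg)+\frac{\mathrm{ber}^r(A^2)}{2\zeta+2}. \end{aligned} $$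
   Context: Reproducing kernel Hilbert space: $X$ is a non-empty set and $\mathcal{H}=\mathcal{H}(X)$ is a Hilbert space of complex-valued functions on $X$ such that for every $x\in X$ the evaluation $\phi\mapsto\phi(x)$ is continuous on $\mathcal{H}$. For $x\in X$, $k_x\in\mathcal{H}$ is the unique element with $\phi(x)=\langle\phi,k_x\rangle$ for all $\phi\in\mathcal{H}$, and $\hat k_x=k_x/\|k_x\|$ is the normalized reproducing kernel (so it is implicit that $k_x\neq 0$ for all $x\in X$). $\mathscr{B}(\mathcal{H})$ is the algebra of bounded linear operators on $\mathcal{H}$, and $|T|=(T^*T)^{1/2}$; powers of positive operators are defined by functional calculus. For $T\in\mathscr{B}(\mathcal{H})$, the Berezin number is $\mathrm{ber}(T)=\sup_{x\in X}|\langle T\hat k_x,\hat k_x\rangle|$ and the Berezin norm is $\|T\|_{\mathrm{ber}}=\sup_{x,y\in X}|\langle T\hat k_x,\hat k_y\rangle|$; $\mathrm{ber}^s(T)$ means $(\mathrm{ber}(T))^s$. *)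

(* Defs.v *)
From HB Require Import structures.
From mathcomp Require Import all_boot all_order all_algebra.
From mathcomp Require Import all_classical all_reals all_analysis.
From mathcomp Require Import sesquilinear complex.

Set Implicit Arguments.
Unset Strict Implicit.
Unset Printing Implicit Defensive.

Import Order.TTheory GRing.Theory Num.Theory.
Import numFieldNormedType.Exports.

Local Open Scope classical_set_scope.
Local Open Scope ring_scope.
Local Open Scope complex_scope.

(* {dot H for Num.conj} is linear in its first argument and conjugate-linear
   in its second one. Norms take their (real, nonnegative) values in R[i]. *)
HB.mixin Record isHilbert (R : realType) H of CompleteNormedModule R[i] H := {
  inner : {dot H for (@Num.conj R[i])};
  sqr_norm_inner : forall u : H, `|u| ^+ 2 = inner u u
}.

#[short(type="hilbertType")]
HB.structure Definition Hilbert (R : realType) :=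
  {H of isHilbert R H & CompleteNormedModule R[i] H}.

(* The elements of H are functions on X through the injective map [feval],
   which carries the vector space structure of H to the pointwise one. *)
HB.mixin Record isRKHS (R : realType) (X : Type) H of Hilbert R H := {
  feval : H -> X -> R[i];
  feval_linear : forall (a : R[i]) (f g : H) (x : X),
    feval (a *: f + g) x = a * feval f x + feval g x;
  feval_inj : injective feval;
  feval_continuous : forall x : X, continuous (fun f : H => feval f x : R[i]^o)
}.

#[short(type="rkhsType")]
HB.structure Definition RKHS (R : realType) (X : Type) :=
  {H of isRKHS R X H & Hilbert R H}.

Section Operators.
Context {R : realType} {H : hilbertType R}.
Implicit Types (S T : H -> H) (f : R -> R) (p : {poly R}).

Definition bounded_op T : Prop :=
  linear T /\ exists M : R, forall u, `|T u| <= M%:C * `|u|.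

(* For T bounded, such a w exists and is unique by the Riesz theorem. *)
Definition adjoint T : H -> H :=
  fun v => xget 0 [set w | forall u, inner (T u) v = inner u w].

Definition spectrum T : set R[i] :=
  [set l | ~ exists2 S, bounded_op S &
       (forall u, S (T u - l *: u) = u) /\ (forall u, T (S u) - l *: S u = u)].

Definition horner_op p T : H -> H :=
  fun u => \sum_(i < size p) (p`_i)%:C *: iter i T u.

(* Continuous functional calculus of a self-adjoint operator T, whose spectrum
   is real: f(T) is the limit in operator norm of p_n(T), for real polynomials
   p_n converging to f uniformly on the spectrum. *)
Definition is_fcalc f T S : Prop :=
  exists p_ : nat -> {poly R},
    {uniform [set t : R | spectrum T t%:C],
       (fun n t => (p_ n).[t]) @ \oo --> f} /\
    (forall e : R, 0 < e -> \forall n \near \oo,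
       forall u, `|horner_op (p_ n) T u - S u| <= e%:C * `|u|).

Definition fcalc f T : H -> H :=
  xget (fun=> 0) [set S | bounded_op S /\ is_fcalc f T S].

(* T^s, for T positive and s > 0 *)
Definition op_powR T (s : R) : H -> H := fcalc (fun t => t `^ s) T.

Definition op_abs T : H -> H := op_powR (adjoint T \o T) 2^-1.

End Operators.

Section Berezin.
Context {R : realType} {X : Type} {H : rkhsType R X}.
Implicit Types (T : H -> H) (x : X).

(* As f |-> f(x) is continuous, such a k exists and is unique. *)
Definition repr_kernel x : H :=
  xget 0 [set k : H | forall f : H, feval f x = inner f k].

Definition nrepr_kernel x : H := `|repr_kernel x|^-1 *: repr_kernel x.

(* For a complex z, [complex.Re `|z|] is the modulus of z as an element of R. *)
Definition ber T : R :=
  sup [set complex.Re `|inner (T (nrepr_kernel x)) (nrepr_kernel x)|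
         | x in [set: X]].

Definition ber_norm T : R :=
  sup [set complex.Re `|inner (T (nrepr_kernel xy.1)) (nrepr_kernel xy.2)|
         | xy in [set: X * X]].

End Berezin.

(* Main.v *)
Require Import Defs.
From HB Require Import structures.
From mathcomp Require Import all_boot all_order all_algebra.
From mathcomp Require Import all_classical all_reals all_analysis.
From mathcomp Require Import sesquilinear complex.
From mathcomp Require Import ring lra.

(* For a unit vector [k], Buzano's inequality and Cauchy-Schwarz give
   [|<A k, k>|^2 <= t a b + (1 - t) |<A^2 k, k>|] with [a = |A k|],
   [b = |A^* k|] and [t = (2 zeta + 1) / (2 zeta + 2)]. Convexity of [x^r]
   leaves [(a b)^r = (a b) (a b)^(r - 1)], where both factors are bounded by
   Young's inequality, and the Hoelder-McCarthy inequality
   [|A k|^(2 s) <= <|A|^(2 s) k, k>], [s >= 1], turns the powers of [a] and [b]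
   into Berezin norms.

   The functional calculus rests on one fact: for [T] self-adjoint and [q] a
   real polynomial, [m = inf <q(T) u, u>] over unit vectors is a value of [q]
   on the real spectrum of [T]. Otherwise [q - m] splits over the complex
   numbers into factors [X - z] for which [T - z] is bounded below, hence so is
   [q(T) - m]; but [q(T) - m >= 0] has infimum [0], so Cauchy-Schwarz for its
   form yields unit vectors that it sends arbitrarily close to [0]. Thus
   [q(T) >= 0] as soon as [q >= 0] on the spectrum. *)

Set Implicit Arguments.
Unset Strict Implicit.
Unset Printing Implicit Defensive.

Import Order.TTheory GRing.Theory Num.Theory.
Import numFieldNormedType.Exports.

Local Open Scope classical_set_scope.
Local Open Scope ring_scope.
Local Open Scope complex_scope.

(** * The real inner product underlying [H], and Cauchy-Schwarz *)

Section RealInner.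
Context {R : realType} {H : hilbertType R}.
Implicit Types (u v w : H) (a b : R) (c : R[i]).

(** Real parts make [H] a real inner product space with values in [R], where order arguments are
    available. *)
Definition ip u v : R := complex.Re (inner u v).
Definition nm u : R := complex.Re `|u|.

Lemma norm_nm u : `|u| = (nm u)%:C.
Proof. by rewrite RRe_real // ger0_real. Qed.

Lemma nm_ge0 u : 0 <= nm u.
Proof. by have := normr_ge0 u; rewrite norm_nm ler0c. Qed.

Lemma sqr_nm u : nm u ^+ 2 = ip u u.
Proof. by rewrite /ip -sqr_norm_inner norm_nm -rmorphXn. Qed.

Lemma ip_ge0 u : 0 <= ip u u.
Proof. by rewrite -sqr_nm exprn_ge0 ?nm_ge0. Qed.

Lemma nm0 : nm 0 = 0. Proof. by rewrite /nm normr0. Qed.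

Lemma nm_eq0 u : (nm u == 0) = (u == 0).
Proof. by rewrite -(@normr_eq0 _ H u) norm_nm -(inj_eq (@complexI R)) rmorph0.
Qed.

Lemma nmD u v : nm (u + v) <= nm u + nm v.
Proof. by have := ler_normD u v; rewrite !norm_nm -rmorphD lecR. Qed.

Lemma nmN u : nm (- u) = nm u. Proof. by rewrite /nm normrN. Qed.

Lemma nm_distC u v : nm (u - v) = nm (v - u). Proof. by rewrite /nm distrC. Qed.

Lemma nmZ a u : nm (a%:C *: u) = `|a| * nm u.
Proof.
rewrite /nm normrZ norm_nm normc_def /= expr0n addr0 sqrtr_sqr.
by rewrite mulr0 subr0.
Qed.

(** Both conjugates give [|c| ^+ 2] when multiplied by [c]. *)
Lemma conjcE c : Num.conj c = conjc c.
Proof.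
have [->|c0] := eqVneq c 0; first by rewrite !rmorph0.
by apply: (mulfI c0); rewrite -normCK sqr_normc.
Qed.

Lemma innerZr c u v : inner u (c *: v) = conjc c * inner u v.
Proof. by rewrite -conjcE linearZr_LR. Qed.

Lemma innerZl c u v : inner (c *: u) v = c * inner u v.
Proof. exact: linearZl_LR. Qed.

Lemma innerC u v : inner u v = conjc (inner v u).
Proof. by rewrite hermC expr0 mul1r; exact: conjcE. Qed.

Lemma ipC u v : ip u v = ip v u.
Proof. by rewrite /ip innerC; case: (inner v u). Qed.

Lemma ipDl u v w : ip (u + v) w = ip u w + ip v w.
Proof. by rewrite /ip linearDl /=; case: (inner u w) => ? ?;
  case: (inner v w). Qed.

Lemma ipNl u w : ip (- u) w = - ip u w.
Proof. by rewrite /ip linearNl /=; case: (inner _ _) => ? ?. Qed.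

Lemma ipZl a u w : ip (a%:C *: u) w = a * ip u w.
Proof. by rewrite /ip linearZl_LR /=; case: (inner _ _) => ? ? /=;
  rewrite mul0r subr0. Qed.

Lemma ipBl u v w : ip (u - v) w = ip u w - ip v w.
Proof. by rewrite ipDl ipNl. Qed.

Lemma ipDr u v w : ip w (u + v) = ip w u + ip w v.
Proof. by rewrite !(ipC w) ipDl. Qed.

Lemma ipZr a u w : ip w (a%:C *: u) = a * ip w u.
Proof. by rewrite !(ipC w) ipZl. Qed.

Lemma sqr_norm_subZ c u v : `|u - c *: v| ^+ 2 =
  `|u| ^+ 2 - (conjc c * inner u v + c * inner v u) + c * conjc c * `|v| ^+ 2.
Proof.
rewrite !sqr_norm_inner linearBl /= !linearBr /= !(innerZl, innerZr).
ring.
Qed.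

Lemma inner_CS u v : `|inner u v| <= `|u| * `|v|.
Proof.
have [->|v0] := eqVneq v 0; first by rewrite linear0r normr0 mulr_ge0.
rewrite -(@ler_pXn2r _ 2) ?nnegrE ?mulr_ge0 //.
have v2 : `|v| ^+ 2 != 0 by rewrite expf_eq0 /= normr_eq0.
(* The residual of the projection of [u] on [v] has nonnegative squared norm. *)
have := exprn_ge0 2 (normr_ge0 (u - (inner u v / `|v| ^+ 2) *: v)).
have v2r : conjc (`|v| ^+ 2) = `|v| ^+ 2.
  by rewrite norm_nm -rmorphXn; exact: conjc_real.
rewrite sqr_norm_subZ rmorphM /= conjc_inv v2r (innerC v u) sqr_normc exprMn.
move=> h.
rewrite -subr_ge0.
have := mulr_ge0 h (exprn_ge0 2 (normr_ge0 v)).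
congr (_ <= _); field.
by rewrite normr_eq0.
Qed.
End RealInner.

(** * Completeness, minimization of quadratic functionals, adjoints and inverses *)

Section Complete.
Context {R : realType} {H : hilbertType R}.
Implicit Types (u v w : H) (T : H -> H).

Lemma ip_CS u v : `|ip u v| <= nm u * nm v.
Proof.
rewrite -lecR rmorphM /= -!norm_nm; apply: le_trans (inner_CS u v).
exact: normc_ge_Re.
Qed.

Lemma nm_complete (u : nat -> H) :
  (forall e : R, 0 < e -> exists N, forall m n, (N <= m)%N -> (N <= n)%N ->
     nm (u m - u n) < e) ->
  exists l, forall e : R, 0 < e -> exists N, forall n, (N <= n)%N ->
     nm (u n - l) < e.
Proof.
move=> cu.
have : cvgn u.
  apply/cauchy_cvgP; apply/cauchy_ballP => e e0; rewrite near_map2.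
  (* A positive element of [R[i]] is real, so [e] is determined by its real part. *)
  have ee : (complex.Re e)%:C = e by rewrite RRe_real // gtr0_real.
  have /cu[N uN] : 0 < complex.Re e by rewrite -ltcR ee.
  exists ([set n | N <= n]%N, [set n | N <= n]%N); first by split; exists N.
  move=> [m n] [/= Nm Nn].
  by rewrite -ball_normE /= norm_nm -ee ltcR; apply: uN.
move=> /cvg_ex[l ul]; exists l => e e0.
have /cvgrPdist_lt/(_ e%:C) := ul.
rewrite ltcR => /(_ e0)[N _ uN]; exists N => n Nn.
by have := uN _ Nn; rewrite /= norm_nm ltcR nm_distC.
Qed.

Section Linear.
Variable (T : H -> H).
Hypothesis lT : linear T.

Lemma lin0 : T 0 = 0.
Proof. by have := lT (-1) 0 0; rewrite scaler0 addr0 scaleN1r addNr. Qed.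
Lemma linD u v : T (u + v) = T u + T v.
Proof. by have := lT 1 u v; rewrite !scale1r. Qed.
Lemma linZ c u : T (c *: u) = c *: T u.
Proof. by have := lT c u 0; rewrite lin0 !addr0. Qed.
Lemma linN u : T (- u) = - T u.
Proof. by rewrite -scaleN1r linZ scaleN1r. Qed.
Lemma linB u v : T (u - v) = T u - T v.
Proof. by rewrite linD linN. Qed.
End Linear.

Lemma bounded_opP T : bounded_op T <->
  linear T /\ exists2 M : R, 0 < M & forall u, nm (T u) <= M * nm u.
Proof.
split=> -[lT]; last first.
  by case=> M M0 TM; split=> //; exists M => u; rewrite !norm_nm -rmorphM lecR.
case=> M TM; split=> //; exists (`|M| + 1); first by rewrite ltr_wpDl.
move=> u; have := TM u; rewrite !norm_nm -rmorphM lecR => /le_trans; apply.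
by rewrite ler_wpM2r ?nm_ge0 // (le_trans (ler_norm _)) // lerDl.
Qed.

Lemma bounded_op_comp S T : bounded_op S -> bounded_op T ->
  bounded_op (S \o T : H -> H).
Proof.
move=> /bounded_opP[lS [M M0 SM]] /bounded_opP[lT [N N0 TN]];
  apply/bounded_opP; split.
  by move=> a u v; rewrite /= lT lS.
exists (M * N); first by rewrite mulr_gt0.
move=> u; apply: le_trans (SM _) _; by rewrite -mulrA ler_wpM2l // ltW.
Qed.

Lemma archi_inv (e : R) : 0 < e ->
  exists N, forall n, (N <= n)%N -> n.+1%:R^-1 < e.
Proof.
move=> e0; exists (Num.truncn e^-1) => n Nn.
rewrite invf_plt ?posrE //.
by apply: lt_le_trans (truncnS_gt _) _; rewrite ler_nat.
Qed.

Lemma discriminant_le (a b c : R) : 0 <= c ->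
  (forall t, 0 <= a + 2 * t * b + t ^+ 2 * c) -> b ^+ 2 <= a * c.
Proof.
rewrite le_eqVlt => /predU1P[<-|c0] h.
  rewrite mulr0; have [->|b0] := eqVneq b 0; first by rewrite expr0n.
  (* With [c = 0] and [b != 0], this [t] gives the value [-1]. *)
  have := h (- (a + 1) / (2 * b)).
  have -> : 2 * (- (a + 1) / (2 * b)) * b = - (a + 1) by field.
  by rewrite mulr0; lra.
rewrite -subr_ge0; have := mulr_ge0 (h (- b / c)) (ltW c0).
congr (_ <= _); field; exact: lt0r_neq0.
Qed.

Definition symmetric_op T := forall u v, ip (T u) v = ip u (T v).

(* Cauchy-Schwarz for the form [ip (S u) v], at [v = S u]. *)
Lemma psd_sqr_nm_le S (L : R) : 0 <= L -> linear S -> symmetric_op S ->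
    (forall u, 0 <= ip (S u) u) -> (forall u, ip (S u) u <= L * nm u ^+ 2) ->
  forall u, nm (S u) ^+ 2 <= L * ip (S u) u.
Proof.
move=> L0 lS sS S0 SL u.
have : ip (S u) (S u) ^+ 2 <= ip (S u) u * ip (S (S u)) (S u).
  apply: discriminant_le => // t; have := S0 (u + t%:C *: S u).
  rewrite linD // linZ // ipDl !ipDr !ipZl !ipZr (sS (S u) u).
  by congr (_ <= _); ring.
have := SL (S u); rewrite -sqr_nm -exprM.
have := S0 u; have := S0 (S u); have := nm_ge0 (S u).
set x := nm (S u); set y := ip (S u) u; set z := ip _ _.
move=> x0 z0 y0 zL xyz.
have [->|xn0] := eqVneq x 0.
  by rewrite expr0n mulr_ge0.
have x2 : 0 < x ^+ 2 by rewrite exprn_gt0 // lt_def xn0.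
rewrite -(ler_pM2r x2) -exprD (le_trans xyz) // mulrAC [leRHS]mulrC.
by rewrite ler_wpM2l.
Qed.

(* [w] is the limit of a minimizing sequence of [ip (S u) u - 2 * f u], for
   which the first variation is asymptotically zero. *)
Lemma lax_milgram (S : H -> H) (f : H -> R) (d L M : R) :
    linear S -> symmetric_op S -> 0 < d ->
      (forall u, d * nm u ^+ 2 <= ip (S u) u) ->
    0 < L -> (forall u, nm (S u) <= L * nm u) ->
    (forall u v, f (u + v) = f u + f v) ->
    (forall (a : R) u, f (a%:C *: u) = a * f u) ->
    (forall u, f u <= M * nm u) ->
  exists w, forall u, f u = ip (S w) u.
Proof.
move=> lS sS d0 Sd L0 SL fD fZ fM.
pose J u := ip (S u) u - 2 * f u.
have S0 u : 0 <= ip (S u) u.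
  by apply: le_trans (Sd u); rewrite mulr_ge0 ?sqr_ge0 // ltW.
have Jlb u : - (M ^+ 2 / d) <= J u.
  rewrite lerNl ler_pdivlMr // /J.
  have := fM u; have := Sd u; have := sqr_ge0 (d * nm u - M).
  set x := nm u => h1 h2 h3; nra.
have infJ : has_inf (range J).
  split; first by exists (J 0), 0.
  by exists (- (M ^+ 2 / d)) => _ [u _ <-].
set m := inf (range J).
have mJ u : m <= J u by apply: ge_inf; [case: infJ | exists u].
(* Since [ip (S v) v <= L * nm v ^+ 2], this excess becomes the rate [n.+1%:R^-1] in [var]. *)
have ex n : exists u, J u < m + n.+1%:R^-1 ^+ 2 / L.
  have [|_ [u _ <-] uJ] := @inf_adherent _ _ (n.+1%:R^-1 ^+ 2 / L) _ infJ.
    by rewrite divr_gt0 // exprn_gt0 // invr_gt0.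
  by exists u.
pose u_ n := projT1 (cid (ex n)).
have uJ n : J (u_ n) < m + n.+1%:R^-1 ^+ 2 / L by rewrite /u_; case: cid.
have var n v : `|ip (S (u_ n)) v - f v| <= n.+1%:R^-1 * nm v.
  rewrite -ler_sqr ?nnegrE ?mulr_ge0 ?nm_ge0 // real_normK ?num_real // exprMn.
  have : (ip (S (u_ n)) v - f v) ^+ 2 <= n.+1%:R^-1 ^+ 2 / L * ip (S v) v.
    (* [J (u_ n + t%:C *: v)] is at least [m] for every [t], while [J (u_ n)] is almost [m]: a
       quadratic in [t] is nonnegative. *)
    apply: discriminant_le => // t.
    have := mJ (u_ n + t%:C *: v); have := uJ n.
    rewrite /J (linD lS) (linZ lS) ipDl !ipDr fD fZ !ipZl !ipZr.
    rewrite (sS v (u_ n)) (ipC v (S (u_ n))).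
    by move: (_ ^+ 2 / L) => e; lra.
  move=> /le_trans; apply; rewrite -mulrA ler_wpM2l ?sqr_ge0 //.
  rewrite ler_pdivrMl // mulrC expr2 mulrAC.
  apply: le_trans (ler_norm _) _; apply: le_trans (ip_CS _ _) _.
  by rewrite ler_wpM2r ?nm_ge0 // mulrC.
have [e e0|w uw] := @nm_complete u_.
  have /archi_inv[N eN] : 0 < d * e / 2 by rewrite divr_gt0 ?mulr_gt0.
  exists N => k n Nk Nn.
  set v := u_ k - u_ n; have [->|v0] := eqVneq v 0; first by rewrite nm0.
  have nv : 0 < nm v by rewrite lt_def nm_eq0 v0 nm_ge0.
  rewrite -(ltr_pM2r nv) -(ltr_pM2l d0) -expr2.
  (* The variations at [u_ k] and [u_ n] in the direction [v] differ by [ip (S v) v], so coercivity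
     makes the sequence Cauchy. *)
  apply: le_lt_trans (Sd v) _; rewrite {1}/v (linB lS) ipBl.
  have := var k v; have := var n v; have := eN _ Nk; have := eN _ Nn.
  move: (k.+1%:R^-1) (n.+1%:R^-1) => x y c c'.
  rewrite !ler_norml => /andP[a _] /andP[_ b].
  have : (y + x) * nm v < d * e * nm v by rewrite ltr_pM2r //; lra.
  by rewrite mulrDl; lra.
exists w => v; apply/eqP; rewrite eq_sym -subr_eq0 -normr_le0.
apply/ler_addgt0Pr => e e0; rewrite add0r.
set e' := e / (2 * (nm v + 1)).
have v1 : 0 < nm v + 1 by rewrite ltr_wpDl ?nm_ge0.
have e1 : 0 < e' by rewrite divr_gt0 // mulr_gt0.
have [N1 h1] := archi_inv e1; have [N2 h2] := uw _ (divr_gt0 e1 L0).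
pose n := maxn N1 N2.
have := h1 n (leq_maxl _ _); have := h2 n (leq_maxr _ _).
have := var n v; have := ip_CS (S (u_ n - w)) v.
have -> : ip (S w) v - f v = (ip (S (u_ n)) v - f v) - ip (S (u_ n - w)) v.
  by rewrite (linB lS) ipBl; lra.
move=> a b; rewrite ltr_pdivlMr // mulrC => c1 c2.
apply: le_trans (ler_normB _ _) _.
apply: le_trans (lerD b a) _; rewrite -mulrDl.
have -> : e = (e' + e') * (nm v + 1) by rewrite /e'; field; exact: lt0r_neq0.
apply: ler_pM; rewrite ?nm_ge0 ?addr_ge0 ?nm_ge0 ?invr_ge0 //; last by lra.
by apply: lerD; rewrite ltW // (le_lt_trans (SL _)).
Qed.

(** Riesz representation: [lax_milgram] at the identity represents the real part, and testing at
    ['i *: a] recovers the imaginary part, so [xget] finds a witness. *)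
Lemma adjointP T : bounded_op T ->
  forall u v, inner (T u) v = inner u (adjoint T v).
Proof.
move=> /bounded_opP[lT [M M0 TM]] u v; rewrite /adjoint.
case: xgetP => [w _ -> //|] no; exfalso.
have [|||||||||w hw] :=
  @lax_milgram id (fun u => ip (T u) v) 1 1 (M * nm v) => //.
- by move=> a; rewrite mul1r sqr_nm.
- by move=> a; rewrite mul1r.
- by move=> a b; rewrite linD // ipDl.
- by move=> a b; rewrite linZ // ipZl.
- move=> w0; apply: le_trans (ler_norm _) _; apply: le_trans (ip_CS _ _) _.
  by rewrite mulrAC ler_wpM2r ?nm_ge0.
apply: (no w) => a.
have := hw a; have := hw ('i *: a); rewrite linZ // !(ipC w) /ip !innerZl.
case: (inner (T a) v) => x y; case: (inner a w) => x' y' /=.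
by rewrite !mul0r !mul1r !sub0r => /oppr_inj -> ->.
Qed.

Lemma inner_inj u v : (forall w, inner w u = inner w v) -> u = v.
Proof.
move=> uv; apply/eqP; rewrite -subr_eq0 -(@normr_eq0 _ H).
by rewrite -sqrf_eq0 sqr_norm_inner linearBr /= uv subrr.
Qed.

Lemma bounded_op_adjoint T : bounded_op T -> bounded_op (adjoint T).
Proof.
move=> bT; have aT := adjointP bT.
move/bounded_opP: bT => [lT [M M0 TM]]; apply/bounded_opP; split.
  move=> c u v; apply: inner_inj => w.
  by rewrite -aT !linearDr /= !innerZr !aT.
exists M => // u; set v := adjoint T u.
have [->|v0] := eqVneq v 0; first by rewrite nm0 mulr_ge0 ?nm_ge0 // ltW.
have nv : 0 < nm v by rewrite lt_def nm_eq0 v0 nm_ge0.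
rewrite -(ler_pM2r nv) -expr2 sqr_nm {2}/v /ip -aT.
apply: le_trans (ler_norm _) _; apply: le_trans (ip_CS _ _) _.
by rewrite mulrAC ler_wpM2r ?nm_ge0.
Qed.

(** [lax_milgram] for the functional [ip v] solves [S w = v]; Cauchy-Schwarz turns coercivity into
    [d * nm u <= nm (S u)], which gives injectivity and the bound [d^-1] on the inverse. *)
Lemma coercive_inverse (S : H -> H) (d : R) : bounded_op S -> symmetric_op S ->
    0 < d -> (forall u, d * nm u ^+ 2 <= ip (S u) u) ->
  exists2 S', bounded_op S' & cancel S S' /\ cancel S' S.
Proof.
move=> /bounded_opP[lS [L L0 SL]] sS d0 Sd.
have surj v : exists w, S w = v.
  have [|||w hw] := @lax_milgram S (ip v) d L (nm v) lS sS d0 Sd L0 SL.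
  - by move=> a b; rewrite ipDr.
  - by move=> a b; rewrite ipZr.
  - by move=> u; apply: le_trans (ip_CS _ _); exact: ler_norm.
  exists w; apply/eqP; rewrite -subr_eq0 -nm_eq0 -sqrf_eq0 sqr_nm.
  by rewrite ipBl hw subrr.
have Sn u : d * nm u <= nm (S u).
  have [->|u0] := eqVneq u 0; first by rewrite nm0 mulr0 nm_ge0.
  have nu : 0 < nm u by rewrite lt_def nm_eq0 u0 nm_ge0.
  rewrite -(ler_pM2r nu) -mulrA -expr2 (le_trans (Sd u)) //.
  by apply: le_trans (ip_CS _ _); exact: ler_norm.
have inj : injective S.
  move=> u v uv; apply/eqP; rewrite -subr_eq0 -nm_eq0 eq_le nm_ge0 andbT.
  by rewrite -(ler_pM2l d0) mulr0 (le_trans (Sn _)) // (linB lS) uv subrr nm0.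
pose S' v := projT1 (cid (surj v)).
have S'K v : S (S' v) = v by rewrite /S'; case: cid.
exists S'; last by split=> u; [apply: inj; rewrite S'K | rewrite S'K].
apply/bounded_opP; split; first by move=> a u v; apply: inj; rewrite lS !S'K.
exists d^-1 => [|u]; first by rewrite invr_gt0.
by rewrite mulrC ler_pdivlMr // mulrC (le_trans (Sn _)) ?S'K.
Qed.

End Complete.

(** * Polynomials in an operator and bounds from below *)

Section PolyOp.
Context {R : realType} {H : hilbertType R}.
Implicit Types (u v w : H) (P Q : {poly R[i]}) (p q : {poly R}).

(** Complex coefficients allow the splitting into linear factors used in
    [cpoly_op_bounded_below]. *)
Definition cpoly_op P (T : H -> H) u : H :=
  \sum_(i < size P) P`_i *: iter i T u.

(** Padding with zero coefficients lets polynomials of different sizes share one index range. *)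
Lemma cpoly_op_wide n P T u : (size P <= n)%N ->
  cpoly_op P T u = \sum_(i < n) P`_i *: iter i T u.
Proof.
move=> Pn; rewrite /cpoly_op (big_ord_widen _ (fun i => P`_i *: iter i T u) Pn).
rewrite big_mkcond; apply: eq_bigr => i _; case: ltnP => // h.
by rewrite nth_default // scale0r.
Qed.

Lemma horner_opE p T : horner_op p T = cpoly_op (map_poly (real_complex R) p) T.
Proof.
apply/funext => u; rewrite /horner_op /cpoly_op size_map_poly.
by apply: eq_bigr => i _; rewrite coef_map.
Qed.

Section LinT.
Variable T : H -> H.
Hypothesis lT : linear T.

Lemma cpoly_opD P Q u : cpoly_op (P + Q) T u = cpoly_op P T u + cpoly_op Q T u.
Proof.
pose n := maxn (size P) (size Q).
rewrite !(@cpoly_op_wide n) ?leq_maxl ?leq_maxr ?(leq_trans (size_polyD _ _))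
  //.
by rewrite -big_split; apply: eq_bigr => i _; rewrite coefD scalerDl.
Qed.

Lemma cpoly_opC c u : cpoly_op c%:P T u = c *: u.
Proof. by rewrite (@cpoly_op_wide 1) ?size_polyC_leq1 // big_ord1 coefC. Qed.

Lemma cpoly_opMC c P u : cpoly_op (c%:P * P) T u = c *: cpoly_op P T u.
Proof.
rewrite !(@cpoly_op_wide (size P)) ?mul_polyC ?size_scale_leq //.
by rewrite scaler_sumr; apply: eq_bigr => i _; rewrite coefZ scalerA.
Qed.

Lemma cpoly_opMX P u : cpoly_op (P * 'X) T u = cpoly_op P T (T u).
Proof.
rewrite (@cpoly_op_wide (size P).+1) ?(leq_trans (size_polyMleq _ _))
  ?size_polyX ?addn2 //.
rewrite big_ord_recl coefMX eqxx scale0r add0r.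
by apply: eq_bigr => i _; rewrite coefMX /= -iterSr.
Qed.

Lemma cpoly_op_comm P u : cpoly_op P T (T u) = T (cpoly_op P T u).
Proof.
rewrite /cpoly_op (big_morph T (linD lT) (lin0 lT)).
by apply: eq_bigr => i _; rewrite linZ // -iterSr.
Qed.

Lemma cpoly_opM P Q u : cpoly_op (P * Q) T u = cpoly_op P T (cpoly_op Q T u).
Proof.
elim/poly_ind: P u => [|P c IH] u;
  first by rewrite mul0r !(cpoly_opC 0) !scale0r.
rewrite mulrDl !cpoly_opD cpoly_opMC cpoly_opC; congr (_ + _).
by rewrite -mulrA (mulrC 'X) mulrA !cpoly_opMX IH cpoly_op_comm.
Qed.

Lemma cpoly_op_linear P : linear (cpoly_op P T).
Proof.
elim/poly_ind: P => [|P c IH] a u v;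
  first by rewrite !(cpoly_opC 0) !scale0r scaler0 addr0.
rewrite !cpoly_opD !cpoly_opMX lT IH !cpoly_opC scalerDr scalerDr scalerA mulrC
  -scalerA.
by rewrite addrACA.
Qed.

End LinT.

Definition selfadj (T : H -> H) := forall u v, inner (T u) v = inner u (T v).

Lemma selfadj_symmetric T : selfadj T -> symmetric_op T.
Proof. by move=> sT u v; rewrite /ip sT. Qed.

Section Hop.
Variable T : H -> H.
Hypothesis bT : bounded_op T.
Let lT : linear T := bT.1.

Lemma horner_opD p q u :
  horner_op (p + q) T u = horner_op p T u + horner_op q T u.
Proof. by rewrite !horner_opE rmorphD cpoly_opD. Qed.

Lemma horner_opC (a : R) u : horner_op a%:P T u = a%:C *: u.
Proof. by rewrite !horner_opE map_polyC cpoly_opC. Qed.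

Lemma horner_opM p q u :
  horner_op (p * q) T u = horner_op p T (horner_op q T u).
Proof. by rewrite !horner_opE rmorphM cpoly_opM. Qed.

Lemma horner_opZ (a : R) p u : horner_op (a *: p) T u = a%:C *: horner_op p T u.
Proof. by rewrite -mul_polyC horner_opM horner_opC. Qed.

Lemma horner_opB p q u :
  horner_op (p - q) T u = horner_op p T u - horner_op q T u.
Proof. by rewrite horner_opD -scaleN1r horner_opZ rmorphN1 scaleN1r. Qed.

Lemma horner_opX u : horner_op 'X T u = T u.
Proof. by rewrite !horner_opE map_polyX -['X]mul1r cpoly_opMX (cpoly_opC T)
  scale1r. Qed.

Lemma horner_op_linear p : linear (horner_op p T).
Proof. by rewrite horner_opE; exact: cpoly_op_linear. Qed.

Lemma horner_op_bounded p : bounded_op (horner_op p T).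
Proof.
apply/bounded_opP; split; first exact: horner_op_linear.
have [_ [M M0 TM]] := (bounded_opP T).1 bT.
elim/poly_ind: p => [|p c [L L0 IH]].
  by exists 1 => // u; rewrite (horner_opC 0) scale0r nm0 mulr_ge0 ?nm_ge0.
exists (L * M + (`|c| + 1)); first by rewrite addr_gt0 ?mulr_gt0 ?ltr_wpDl.
move=> u; rewrite horner_opD horner_opM horner_opX horner_opC mulrDl (le_trans
  (nmD _ _)) // lerD //.
  by rewrite (le_trans (IH _)) // -mulrA ler_wpM2l // ltW.
by rewrite nmZ ler_wpM2r ?nm_ge0 // lerDl.
Qed.

Lemma horner_op_selfadj p : selfadj T -> selfadj (horner_op p T).
Proof.
move=> sT; elim/poly_ind: p => [|p c IH] u v.
  by rewrite !(horner_opC 0) !scale0r linear0l linear0r.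
rewrite !horner_opD !horner_opM !horner_opX linearDl linearDr /= IH sT
  !horner_opC innerZl innerZr.
rewrite conjc_real; congr (inner _ _ + _).
by rewrite -horner_opX -!horner_opM mulrC horner_opM horner_opX.
Qed.
End Hop.

Definition bounded_below (T : H -> H) :=
  exists2 d : R, 0 < d & forall u, d * nm u <= nm (T u).

Lemma nonspectrum_bounded_below T l : ~ spectrum T l ->
  bounded_below (fun u => T u - l *: u).
Proof.
move=> /contrapT[S /bounded_opP[lS [M M0 SM]] [ST _]].
by exists M^-1; rewrite ?invr_gt0 // => u; rewrite ler_pdivrMl // -{1}[u]ST.
Qed.

Lemma selfadj_real T u : selfadj T -> complex.Im (inner (T u) u) = 0.
Proof.
move=> sT; have : inner (T u) u = conjc (inner (T u) u) by rewrite {1}sT innerC.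
by case: (inner _ _) => x y [] /=; lra.
Qed.

(** As [inner (T u) u] is real, the imaginary part of [inner (T u - z *: u) u] is
    [- complex.Im z * nm u ^+ 2]; Cauchy-Schwarz bounds it by [nm (T u - z *: u) * nm u]. *)
Lemma nonreal_bounded_below T z : selfadj T -> complex.Im z != 0 ->
  bounded_below (fun u => T u - z *: u).
Proof.
move=> sT z0; exists `|complex.Im z|; first by rewrite normr_gt0.
move=> u; have [->|u0] := eqVneq u 0; first by rewrite nm0 mulr0 nm_ge0.
have nu : 0 < nm u by rewrite lt_def nm_eq0 u0 nm_ge0.
rewrite -(ler_pM2r nu) -lecR [leRHS]rmorphM /= -!norm_nm.
apply: le_trans (inner_CS _ _).
rewrite linearBl /= innerZl -sqr_norm_inner norm_nm -rmorphXn.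
have := selfadj_real u sT; case: (inner _ _) => x y /= ->.
case: z z0 => a b /= _.
rewrite normc_def lecR /= !mulr0 subr0 !add0r sqrrN -mulrA -expr2.
apply: le_trans (ler_norm _) _; rewrite -sqrtr_sqr ler_wsqrtr //.
by rewrite !exprMn real_normK ?num_real // lerDr sqr_ge0.
Qed.

(** [P] splits over [R[i]], and the lower bounds of the factors [T - z] multiply. *)
Lemma cpoly_op_bounded_below T P : linear T -> P != 0 ->
  (forall z, root P z -> bounded_below (fun u => T u - z *: u)) ->
    bounded_below (cpoly_op P T).
Proof.
move=> lT P0; have [r Pr] := closed_field_poly_normal P.
have lc0 : lead_coef P != 0 by rewrite lead_coef_eq0.
move: (lead_coef P) lc0 Pr => c c0 -> {P P0} h.
have : forall z, z \in r -> bounded_below (fun u => T u - z *: u).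
  by move=> z zr; apply: h; rewrite rootZ // root_prod_XsubC.
elim: r {h} => [|z r IH] h.
  exists (complex.Re `|c|); last first.
    move=> u; rewrite big_nil alg_polyC cpoly_opC -lecR rmorphM /= -!norm_nm
      normrZ.
    by [].
  by rewrite -ltcR RRe_real ?ger0_real // normr_gt0.
have [d d0 hd] : bounded_below (cpoly_op (c *: \prod_(z <- r) ('X - z%:P)) T).
  by apply: IH => y yr; apply: h; rewrite inE yr orbT.
have [e e0 he] := h z (mem_head _ _).
exists (d * e); first by rewrite mulr_gt0.
move=> u; rewrite big_cons (mulrC ('X - _)) scalerAl cpoly_opM //
  (le_trans _ (hd _)) //.
rewrite -mulrA ler_pM2l // -polyCN cpoly_opD cpoly_opC scaleNr.
by rewrite -['X]mul1r cpoly_opMX (cpoly_opC T) scale1r.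
Qed.
End PolyOp.

(** * From positivity on the spectrum to positivity of the operator *)

Section SpectralPositivity.
Context {R : realType} {H : hilbertType R}.
Variable T : H -> H.
Hypotheses (bT : bounded_op T) (sT : selfadj T).
Implicit Types (u v w : H) (p q : {poly R}).

Definition real_spectrum : set R := [set t | spectrum T t%:C].

Lemma ip_bounded_le (S : H -> H) (M : R) u : (forall v, nm (S v) <= M * nm v) ->
  `|ip (S u) u| <= M * nm u ^+ 2.
Proof.
by move=> SM; apply: le_trans (ip_CS _ _) _;
  rewrite expr2 mulrA ler_wpM2r ?nm_ge0.
Qed.

Lemma horner_op_sym p : symmetric_op (horner_op p T).
Proof. exact/selfadj_symmetric/horner_op_selfadj. Qed.

(** A nonreal root is handled by self-adjointness, a real one by lying outside the spectrum. *)
Lemma horner_op_bounded_below q :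
  q != 0 -> (forall t, real_spectrum t -> q.[t] != 0) ->
  bounded_below (horner_op q T).
Proof.
move=> q0 qt; rewrite horner_opE; apply: cpoly_op_bounded_below;
  first exact: bT.1.
  by rewrite map_poly_eq0.
move=> z qz; have [z0|z0] := eqVneq (complex.Im z) 0;
  last exact: nonreal_bounded_below.
have zE : z = (complex.Re z)%:C by case: z z0 {qz} => a b /= ->.
rewrite zE; apply: nonspectrum_bounded_below => zs; have /negP := qt _ zs;
  apply.
move: qz; rewrite zE rootE -/(real_complex R) horner_map /=.
by rewrite -(inj_eq (@complexI R)).
Qed.

Lemma real_spectrum_min q (v0 : H) : nm v0 = 1 -> (forall m, q != m%:P) ->
  exists2 t, real_spectrum t & forall u,
    q.[t] * nm u ^+ 2 <= ip (horner_op q T u) u.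
Proof.
move=> v01 qnc.
pose A := [set ip (horner_op q T u) u | u in [set u | nm u = 1]].
have [lq [M M0 qM]] := (bounded_opP _).1 (horner_op_bounded bT q).
have iA : has_inf A.
  split; first by exists (ip (horner_op q T v0) v0), v0.
  exists (- M) => _ [u /= u1 <-]; have := ip_bounded_le u qM.
  by rewrite u1 expr1n mulr1 ler_norml => /andP[].
pose m := inf A.
have mA u : m * nm u ^+ 2 <= ip (horner_op q T u) u.
  have [->|u0] := eqVneq u 0.
    by rewrite (lin0 lq) nm0 expr0n mulr0 /ip linear0l.
  have nu : 0 < nm u by rewrite lt_def nm_eq0 u0 nm_ge0.
  have : m <= ip (horner_op q T ((nm u)^-1%:C *: u)) ((nm u)^-1%:C *: u).
    apply: ge_inf; first by case: iA.
    exists ((nm u)^-1%:C *: u) => //=.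
    by rewrite nmZ ger0_norm ?invr_ge0 ?nm_ge0 // mulVf ?gt_eqF.
  rewrite (linZ lq) ipZl ipZr mulrA -invfM -expr2.
  by rewrite ler_pdivlMl ?exprn_gt0 // mulrC.
have [[t st /eqP tm]|noroot] := pselect (exists2 t,
  real_spectrum t & q.[t] == m).
  by exists t => // u; rewrite tm.
exfalso.
have [d d0 hd] : bounded_below (horner_op (q - m%:P) T).
  (* [q] is not constant, so [q - m%:P] is nonzero. *)
  apply: horner_op_bounded_below; first by rewrite subr_eq0.
  move=> t st; apply: contra_notN noroot; rewrite !hornerE subr_eq0 => tm.
  by exists t.
pose S := horner_op (q - m%:P) T.
have ipS u : ip (S u) u = ip (horner_op q T u) u - m * nm u ^+ 2.
  by rewrite /S horner_opB // horner_opC ipBl ipZl sqr_nm.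
have S0 u : 0 <= ip (S u) u by rewrite ipS subr_ge0.
have [lS [L L0 SL]] := (bounded_opP _).1 (horner_op_bounded bT (q - m%:P)).
have SN := psd_sqr_nm_le (ltW L0) lS (horner_op_sym _) S0
  (fun u => le_trans (ler_norm _) (ip_bounded_le u SL)).
(* For a unit [u], [d ^+ 2 <= nm (S u) ^+ 2 <= L * ip (S u) u], so the form of [q(T)] stays at least
   [d ^+ 2 / L] above its infimum [m]. *)
have e0 : 0 < d ^+ 2 / L by rewrite divr_gt0 ?exprn_gt0.
have [_ [u /= u1 <-]] := inf_adherent e0 iA.
rewrite -/m ltNge => /negP; apply.
have := SN u; have := hd u; rewrite u1 mulr1 => du Su.
rewrite -lerBrDl -[m]mulr1 -(expr1n _ 2) -u1 -ipS ler_pdivrMr // mulrC.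
apply: le_trans Su; rewrite ler_sqr ?nnegrE ?nm_ge0 //; exact: ltW.
Qed.

Lemma horner_op_ge0 q : (forall t, real_spectrum t -> 0 <= q.[t]) ->
  forall u, 0 <= ip (horner_op q T u) u.
Proof.
move=> q0 u.
have [->|u0] := eqVneq u 0; first by rewrite /ip linear0r.
have nu : 0 < nm u by rewrite lt_def nm_eq0 u0 nm_ge0.
have v1 : nm ((nm u)^-1%:C *: u) = 1.
  by rewrite nmZ ger0_norm ?invr_ge0 ?nm_ge0 // mulVf ?gt_eqF.
have [[m qm]|qnc] := pselect (exists m, q = m%:P).
  (* A constant escapes [real_spectrum_min]; the polynomial ['X] yields a point of the real spectrum
     at which [q0] can be read. *)
  have [|t st _] := real_spectrum_min (q := 'X) v1.
    by move=> c; apply/eqP => /(congr1 (fun p : {poly R} => size p));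
      rewrite size_polyX size_polyC; case: eqP.
  have := q0 _ st; rewrite qm hornerC horner_opC // ipZl => m0.
  by rewrite mulr_ge0 ?ip_ge0.
have [|t st qt] := real_spectrum_min (q := q) v1.
  by move=> m; apply: contra_notN qnc => /eqP ->; exists m.
by apply: le_trans (qt u); rewrite mulr_ge0 ?q0 // exprn_ge0 // nm_ge0.
Qed.

(** The form of [e + q(T)] lies between [0] and [2 * e] times the squared norm, so [psd_sqr_nm_le]
    bounds the operator by [2 * e]; removing [e] again gives the factor [3]. *)
Lemma horner_op_norm_le q (e : R) :
  0 <= e -> (forall t, real_spectrum t -> `|q.[t]| <= e) ->
  forall u, nm (horner_op q T u) <= 3 * e * nm u.
Proof.
move=> e0 qe u.
pose S := horner_op (e%:P + q) T.
have SE v : S v = e%:C *: v + horner_op q T v by rewrite /S horner_opD //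
  horner_opC.
have S0 v : 0 <= ip (S v) v.
  apply: horner_op_ge0 => t /qe; rewrite !hornerE ler_norml; lra.
have S2 v : ip (S v) v <= 2 * e * nm v ^+ 2.
  have : 0 <= ip (horner_op (e%:P - q) T v) v.
    apply: horner_op_ge0 => t /qe; rewrite !hornerE ler_norml; lra.
  rewrite SE horner_opB // horner_opC // ipBl ipDl ipZl sqr_nm; lra.
have e2 : 0 <= 2 * e by rewrite mulr_ge0.
have := psd_sqr_nm_le e2 (horner_op_linear bT _) (horner_op_sym _) S0 S2 u.
move=> /le_trans/(_ (ler_wpM2l e2 (S2 u))).
rewrite mulrA -expr2 -exprMn ler_sqr ?nnegrE ?mulr_ge0 ?nm_ge0 // => Su.
have -> : horner_op q T u = S u - e%:C *: u by rewrite SE addrAC subrr add0r.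
apply: le_trans (nmD _ _) _; rewrite nmN nmZ ger0_norm //.
move: Su; rewrite /S; lra.
Qed.

End SpectralPositivity.

(** * Existence and order properties of the functional calculus *)

Section Fcalc.
Context {R : realType} {H : hilbertType R}.
Implicit Types (T S : H -> H) (u v w : H) (p q : {poly R}) (f : R -> R).

Lemma uniform_horner_cvgP (A : set R) (p_ : nat -> {poly R}) f :
  {uniform A, (fun n t => (p_ n).[t]) @ \oo --> f} <->
  forall e, 0 < e -> exists N, forall n, (N <= n)%N ->
    forall t, A t -> `|(p_ n).[t] - f t| < e.
Proof.
split=> [pf e e0|h].
  have := pf [set g | forall t, A t -> `|g t - f t| < e].
  case.
    apply/uniform_nbhs; exists [set xy | ball xy.1 e xy.2]; split.
      exact: (entourage_ball _ (PosNum e0)).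
    by move=> g /= h t At; rewrite distrC; exact: h.
  by move=> N _ h; exists N => n Nn; exact: (h n Nn).
move=> P /uniform_nbhs[E [+ EP]]; rewrite -entourage_from_ballE => -[e e0 eE].
have [N hN] := h e e0.
exists N => // n /= Nn; apply: EP => t At; apply: eE.
by rewrite /= /ball /= distrC; exact: hN.
Qed.

Lemma is_fcalcP f T S : is_fcalc f T S <->
  exists p_ : nat -> {poly R},
    (forall e, 0 < e -> exists N, forall n, (N <= n)%N ->
      forall t, real_spectrum T t -> `|(p_ n).[t] - f t| < e) /\
    (forall e, 0 < e -> exists N, forall n, (N <= n)%N ->
      forall u, nm (horner_op (p_ n) T u - S u) <= e * nm u).
Proof.
split=> -[p_ [/uniform_horner_cvgP pf pS]]; exists p_; split=> //.
  move=> e /pS[N _ h]; exists N => n Nn u.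
  by have := h n Nn u; rewrite !norm_nm -rmorphM lecR.
move=> e /pS[N h]; exists N => // n Nn u.
by rewrite !norm_nm -rmorphM lecR h.
Qed.

Lemma nm_eq0_le u : (forall e, 0 < e -> nm u <= e) -> u = 0.
Proof.
move=> h; apply/eqP; rewrite -nm_eq0 eq_le nm_ge0 andbT.
by apply/ler_addgt0Pr => e e0; rewrite add0r h.
Qed.

Lemma nmZC (c : R[i]) u : nm (c *: u) = complex.Re `|c| * nm u.
Proof. by apply: complexI; rewrite rmorphM /= -!norm_nm normrZ. Qed.

Lemma linear_lim S (L : nat -> H -> H) : (forall n, linear (L n)) ->
  (forall e : R, 0 < e -> exists N, forall n, (N <= n)%N ->
     forall u, nm (L n u - S u) <= e * nm u) -> linear S.
Proof.
move=> lL h a u v; apply/eqP; rewrite -subr_eq0; apply/eqP/nm_eq0_le => e e0.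
(* The three error terms below are multiples of [e / K] whose weights sum to [K - 1]; the [1] keeps
   [K] positive. *)
pose K := nm (a *: u + v) + complex.Re `|a| * nm u + nm v + 1.
have a0 : 0 <= complex.Re `|a| by rewrite -ler0c RRe_real ?ger0_real.
have K0 : 0 < K by rewrite ltr_wpDl // !addr_ge0 ?mulr_ge0 ?nm_ge0.
have [N /(_ N (leqnn N)) hN] := h _ (divr_gt0 e0 K0).
have -> : S (a *: u + v) - (a *: S u + S v) =
  (L N v - S v) - (L N (a *: u + v) - S (a *: u + v)) + a *: (L N u - S u).
  rewrite lL scalerBr opprB !opprD !addrA.
  by rewrite [RHS](ACl (1 * 5 * (6 * 4) * (3 * 7 * 2))) /= !subrr !add0r.
apply: le_trans (nmD _ _) _; rewrite nmZC.
apply: (@le_trans _ _ (e / K * nm v + e / K * nm (a *: u + v)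
     + complex.Re `|a| * (e / K * nm u))).
  apply: lerD; last by rewrite ler_wpM2l.
  by apply: le_trans (nmD _ _) _; rewrite nmN lerD.
apply: (@le_trans _ _ (e / K * K)); last by rewrite mulfVK // gt_eqF.
have := divr_gt0 e0 K0; move: (e / K) => x x0; rewrite /K.
by rewrite !mulrDr mulrCA; lra.
Qed.

Lemma is_fcalc_exists f T (p_ : nat -> {poly R}) : bounded_op T -> selfadj T ->
  (forall e, 0 < e -> exists N, forall n, (N <= n)%N ->
      forall t, real_spectrum T t -> `|(p_ n).[t] - f t| < e) ->
  exists S, bounded_op S /\ is_fcalc f T S.
Proof.
move=> bT sT pf.
have cau e : 0 < e -> exists N, forall n m, (N <= n)%N -> (N <= m)%N ->
    forall u, nm (horner_op (p_ n) T u - horner_op (p_ m) T u) <= e * nm u.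
  (* Two polynomials within [e / 6] of [f] differ by at most [e / 3], and [horner_op_norm_le] loses
     a factor [3]. *)
  move=> e0; have [|N hN] := pf (e / 6); first by rewrite divr_gt0.
  exists N => n m Nn Nm u; rewrite -horner_opB //.
  have -> : e = 3 * (e / 3) by field.
  apply: (horner_op_norm_le bT sT); first by rewrite divr_ge0 // ltW.
  move=> t st; rewrite !hornerE.
  have -> : (p_ n).[t] - (p_ m).[t]
    = ((p_ n).[t] - f t) - ((p_ m).[t] - f t) by lra.
  apply: le_trans (ler_normB _ _) _.
  by have := hN n Nn t st; have := hN m Nm t st; lra.
have ex u : exists l, forall e, 0 < e -> exists N, forall n, (N <= n)%N ->
    nm (horner_op (p_ n) T u - l) < e.
  apply: nm_complete => e e0.
  have u0 : 0 < nm u + 1 by rewrite ltr_wpDl ?nm_ge0.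
  have [N hN] := cau _ (divr_gt0 e0 u0).
  exists N => m n Nm Nn; apply: le_lt_trans (hN m n Nm Nn u) _.
  by rewrite mulrAC ltr_pdivrMr // ltr_pM2l // ltrDl.
pose S u := projT1 (cid (ex u)).
(* Letting the second index of [cau] tend to infinity keeps the bound uniform in [u]. *)
have hS e : 0 < e -> exists N, forall n, (N <= n)%N ->
     forall u, nm (horner_op (p_ n) T u - S u) <= e * nm u.
  move=> e0; have [N hN] := cau e e0; exists N => n Nn u.
  apply/ler_addgt0Pr => d d0; rewrite /S; case: cid => l /= hl.
  have [K hK] := hl d d0.
  have := hN n (maxn N K) Nn (leq_maxl _ _) u.
  have := hK (maxn N K) (leq_maxr _ _).
  set x := horner_op _ _ _; set y := horner_op _ _ _ => a b.
  have -> : y - l = (y - x) + (x - l) by rewrite addrA subrK.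
  by apply: le_trans (nmD _ _) _; rewrite lerD // ltW.
exists S; split; last by apply/is_fcalcP; exists p_.
apply/bounded_opP; split.
  by apply: (linear_lim (L := fun n => horner_op (p_ n) T)) hS => n;
    exact: horner_op_linear.
have [N hN] := hS 1 ltr01.
have [lN [M M0 hM]] := (bounded_opP _).1 (horner_op_bounded bT (p_ N)).
exists (M + 1); first by rewrite addr_gt0.
move=> u.
have -> : S u = horner_op (p_ N) T u - (horner_op (p_ N) T u - S u).
  by rewrite opprB addrC subrK.
by apply: le_trans (nmD _ _) _; rewrite nmN mulrDl lerD // hN.
Qed.

(** For [t < 0] the operator [T - t] is coercive, and for [t > M] so is [t - T]; [coercive_inverse]
    then puts [t] outside the spectrum. *)
Lemma real_spectrum_itv T (M : R) : bounded_op T -> selfadj T ->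
  (forall u, 0 <= ip (T u) u) -> (forall u, ip (T u) u <= M * nm u ^+ 2) ->
  forall t, real_spectrum T t -> 0 <= t <= M.
Proof.
move=> bT sT T0 TM t st; apply/andP; split; rewrite leNgt; apply/negP => tlt.
  have [||S bS [K1 K2]] := coercive_inverse (horner_op_bounded bT ('X - t%:P))
     (horner_op_sym bT sT _) (d := - t).
  - by rewrite oppr_gt0.
  - move=> u; rewrite horner_opB // horner_opC // horner_opX //
    ipBl ipZl sqr_nm mulNr lerDr.
    exact: T0.
  apply: st; exists S => //; split=> u.
    by have := K1 u; rewrite horner_opB // horner_opC // horner_opX.
  by have := K2 u; rewrite horner_opB // horner_opC // horner_opX.
have [||S bS [K1 K2]] := coercive_inverse (horner_op_bounded bT (t%:P - 'X))
   (horner_op_sym bT sT _) (d := t - M).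
- by rewrite subr_gt0.
- by move=> u; rewrite horner_opB // horner_opC // horner_opX //
  ipBl ipZl sqr_nm mulrBl lerB -?sqr_nm.
have [lS [L L0 SL]] := (bounded_opP _).1 bS.
(* [S] inverts [t - T], so the inverse of [T - t] carries a sign in its argument. *)
apply: st; exists (fun u => S (- u)).
  apply/bounded_opP; split=> [a u v|]; last by exists L => // u;
    rewrite -(nmN u).
  by rewrite opprD -scalerN lS.
split=> u; first by have := K1 u;
  rewrite horner_opB // horner_opC // horner_opX // opprB.
by have := K2 (- u); rewrite horner_opB // horner_opC // horner_opX //
  => /(congr1 -%R); rewrite opprB opprK.
Qed.

(** For large [n], [p_ n + d - q] is nonnegative on the spectrum, so [horner_op_ge0] applies and the
    inequality passes to the limit. *)
Lemma is_fcalc_ge f T S q : bounded_op T -> selfadj T -> is_fcalc f T S ->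
  (forall t, real_spectrum T t -> q.[t] <= f t) ->
  forall u, ip (horner_op q T u) u <= ip (S u) u.
Proof.
move=> bT sT /is_fcalcP[p_ [pf pS]] qf u.
apply/ler_addgt0Pr => e e0.
have u1 : 0 < nm u ^+ 2 + 1 by rewrite ltr_wpDl ?sqr_ge0.
(* One [d] pays for the error of [p_ n] on the spectrum, another for the error in operator norm. *)
pose d := e / (2 * (nm u ^+ 2 + 1)).
have d0 : 0 < d by rewrite divr_gt0 // mulr_gt0.
have [N1 h1] := pf d d0; have [N2 h2] := pS d d0.
pose n := maxn N1 N2.
have := h1 n (leq_maxl _ _); have {h1 h2} h2 := h2 n (leq_maxr _ _) => h1.
have : 0 <= ip (horner_op (p_ n + d%:P - q) T u) u.
  apply: horner_op_ge0 => // t st; have := h1 t st; have := qf t st.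
  by rewrite !hornerE ltr_norml; lra.
rewrite horner_opB // horner_opD // horner_opC // ipBl ipDl ipZl -sqr_nm.
have := ip_bounded_le u h2; rewrite ler_norml ipBl.
have -> : e = 2 * d * (nm u ^+ 2 + 1) by rewrite /d; field; exact: lt0r_neq0.
by lra.
Qed.

End Fcalc.

(** * Weierstrass approximation by Bernstein polynomials *)

Section Bernstein.
Context {R : realType}.
Implicit Types (g h : nat -> R) (x y e d : R).

(* [bernstein n g] is [\sum_k 'C(n, k) X^k (1 - X)^(n - k) g k]. *)
Fixpoint bernstein n g : {poly R} :=
  if n is n'.+1 then (1 - 'X) * bernstein n' g + 'X * bernstein n' (g \o S)
  else (g 0%N)%:P.

Lemma bernstein_le n g h x : 0 <= x <= 1 ->
  (forall k, (k <= n)%N -> g k <= h k) ->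
  (bernstein n g).[x] <= (bernstein n h).[x].
Proof.
move=> /andP[x0 x1]; elim: n g h => [|n IH] g h gh /=.
  by rewrite !hornerC gh.
rewrite !hornerE; apply: lerD; rewrite ler_wpM2l ?subr_ge0 // IH // => k kn.
  by rewrite gh // leqW.
by rewrite /= gh.
Qed.

Lemma bernstein_affine n (a c : R) g x :
  (bernstein n (fun k => a * g k + c)).[x] = a * (bernstein n g).[x] + c.
Proof.
elim: n g => [|n IH] g /=; first by rewrite !hornerC.
rewrite !hornerE IH (IH (g \o S)); ring.
Qed.

(** The second moment of a binomial variable about [c]: variance plus squared offset of the mean. A
    free [c] absorbs the shift of [k] in the induction. *)
Lemma bernstein_sqr n (c x : R) :
  (bernstein n (fun k => (k%:R - c) ^+ 2)).[x] =
  n%:R * x * (1 - x) + (n%:R * x - c) ^+ 2.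
Proof.
elim: n c => [|n IH] c /=; first by rewrite hornerC; ring.
have -> : (fun k => (k%:R - c) ^+ 2) \o S = fun k => (k%:R - (c - 1)) ^+ 2 :> R.
  by apply/funext => k /=; rewrite -natr1; ring.
by rewrite !hornerE !IH -natr1; ring.
Qed.

(** Bernstein's argument: [f (k%:R / m%:R)] deviates from [f x] by at most [e / 2] near [x], and by
    at most a multiple of the squared distance elsewhere; the binomial variance makes the average of
    the latter small. *)
Lemma weierstrass (f : R -> R) (B : R) :
    (forall e, 0 < e -> exists2 d, 0 < d & forall x y, 0 <= x <= 1 ->
       0 <= y <= 1 -> `|x - y| < d -> `|f x - f y| <= e) ->
    (forall x, 0 <= x <= 1 -> `|f x| <= B) ->
  forall e, 0 < e -> exists p : {poly R}, forall x, 0 <= x <= 1 ->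
    `|p.[x] - f x| <= e.
Proof.
move=> fc fB e e0.
have [|d d0 hd] := fc (e / 2); first by rewrite divr_gt0.
have B0 : 0 <= B by apply: le_trans (fB 0 _); rewrite ?lexx ?ler01.
have K0 : 0 <= 2 * B / d ^+ 2 by rewrite divr_ge0 ?sqr_ge0 ?mulr_ge0.
(* The variance leaves an error of at most [2 * B / d ^+ 2] divided by the degree, here made at most
   [e / 2]. *)
have [n hn] : exists n, 2 * B / d ^+ 2 * n.+1%:R^-1 <= e / 2.
  have e1 : 0 < e / 2 / (2 * B / d ^+ 2 + 1).
    by rewrite !divr_gt0 // ltr_wpDl.
  have [N /(_ N (leqnn N)) hN] := archi_inv e1; exists N.
  move: hN; rewrite ltr_pdivlMr; last first.
    by rewrite ltr_wpDl.
  have : 0 < N.+1%:R^-1 :> R by rewrite invr_gt0.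
  by move: (N.+1%:R^-1) (2 * B / _) (e / 2) => u v w; lra.
set m := n.+1; have m0 : 0 < m%:R :> R by rewrite ltr0Sn.
exists (bernstein m (fun k => f (k%:R / m%:R))) => x x01.
set K := 2 * B / d ^+ 2 / m%:R ^+ 2.
have main k : (k <= m)%N ->
    `|f (k%:R / m%:R) - f x| <= e / 2 + K * (k%:R - m%:R * x) ^+ 2.
  move=> km.
  have k01 : 0 <= (k%:R / m%:R : R) <= 1.
    by rewrite divr_ge0 //= ler_pdivrMr // mul1r ler_nat.
  have KE : K * (k%:R - m%:R * x) ^+ 2 =
     2 * B * ((k%:R / m%:R - x) ^+ 2 / d ^+ 2).
    by rewrite /K; field; rewrite !lt0r_neq0.
  rewrite KE; have [kx|kx] := ltP `|k%:R / m%:R - x| d.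
    rewrite (le_trans (hd _ _ k01 x01 kx)) // lerDl.
    by rewrite mulr_ge0 ?divr_ge0 ?sqr_ge0 ?mulr_ge0.
  (* Away from [x] this ratio is at least [1], while [2 * B] bounds any deviation. *)
  have k1 : 1 <= (k%:R / m%:R - x) ^+ 2 / d ^+ 2.
    rewrite ler_pdivlMr ?exprn_gt0 // mul1r -[leRHS]real_normK ?num_real //.
    by rewrite ler_sqr ?nnegrE // ltW.
  apply: le_trans (ler_normB _ _) _; have := fB _ k01; have := fB _ x01.
  move: k1; set z := _ / d ^+ 2 => z1 h1 h2.
  have : 2 * B <= 2 * B * z by rewrite ler_peMr // mulr_ge0.
  lra.
have bound : (bernstein m (fun k => K * (k%:R - m%:R * x) ^+ 2 + (e / 2))).[x]
    <= e.
  rewrite bernstein_affine bernstein_sqr.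
  rewrite subrr expr0n addr0.
  have -> : K * (m%:R * x * (1 - x)) =
      (2 * B / d ^+ 2 * m%:R^-1) * (x * (1 - x)).
    by rewrite /K; field; rewrite !lt0r_neq0.
  have c0 : 0 <= 2 * B / d ^+ 2 * m%:R^-1.
    by rewrite mulr_ge0 // invr_ge0 ltW.
  have : 2 * B / d ^+ 2 * m%:R^-1 * (x * (1 - x)) <= 2 * B / d ^+ 2 * m%:R^-1.
    by rewrite ler_piMr //; move: x01 => /andP[]; nra.
  by move: hn; rewrite -/m; move: (_ * m%:R^-1) => u; lra.
(* [bernstein_le] compares [f] at the nodes with one parabola below it and one above it. *)
rewrite ler_norml; apply/andP; split.
  have := @bernstein_le m
    (fun k => - 1 * (K * (k%:R - m%:R * x) ^+ 2 + (e / 2)) + f x)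
    (fun k => f (k%:R / m%:R)) x x01.
  rewrite bernstein_affine => h.
  rewrite lerBrDr; apply: le_trans (h _) => [|k km].
    by move: bound; lra.
  by have := main k km; rewrite ler_norml; lra.
have := @bernstein_le m (fun k => f (k%:R / m%:R))
  (fun k => 1 * (K * (k%:R - m%:R * x) ^+ 2 + (e / 2)) + f x) x x01.
rewrite bernstein_affine => h.
rewrite lerBlDr; apply: le_trans (h _) _ => [k km|].
  by have := main k km; rewrite ler_norml; lra.
by move: bound; lra.
Qed.
End Bernstein.

(** * Real powers: tangent lines, uniform continuity, polynomial approximation *)

Section PowR.
Context {R : realType}.
Implicit Types (x y s c e d M : R).

(** Young's inequality for [y * 1] with exponents [s] and [s / (s - 1)], multiplied by [s]. *)
Lemma powR_bernoulli s y : 1 <= s -> 0 <= y -> 1 + s * (y - 1) <= y `^ s.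
Proof.
rewrite le_eqVlt => /predU1P[<- y0|s1 y0]; first by rewrite powRr1 //; lra.
have s0 : 0 < s by lra.
have := @conjugate_powR R y 1 s (s / (s - 1)) y0 ler01 s0.
rewrite mulr1 powR1 invf_div => h.
have {h} h : y <= y `^ s / s + (s - 1) / s.
  rewrite -[(s - 1) / s]mul1r; apply: h; first by rewrite divr_gt0 // subr_gt0.
  by field; exact: lt0r_neq0.
have := ler_wpM2l (ltW s0) h.
have -> : s * (y `^ s / s + (s - 1) / s) = y `^ s + (s - 1).
  by field; exact: lt0r_neq0.
lra.
Qed.

(** Bernoulli's inequality at [y / c], rescaled: the graph of a convex power lies above its tangent
    at [c]. *)
Lemma powR_tangent s c y : 1 <= s -> 0 < c -> 0 <= y ->
  c `^ s + s * c `^ (s - 1) * (y - c) <= y `^ s.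
Proof.
move=> s1 c0 y0.
have := powR_bernoulli s1 (divr_ge0 y0 (ltW c0)).
rewrite -(ler_pM2l (powR_gt0 s c0)) -powRM ?divr_ge0 ?(ltW c0) //
  mulrCA mulfV ?gt_eqF // mulr1.
congr (_ <= _).
have -> : c `^ s = c * c `^ (s - 1) by rewrite mulr_powRB1 //; lra.
by field; exact: lt0r_neq0.
Qed.

(** The exponent [2^-1] serves [op_abs], the exponents [1 <= s] serve its powers. *)
Lemma powR_unif_cont s : s = 2^-1 \/ 1 <= s ->
  forall e, 0 < e -> exists2 d, 0 < d & forall x y, 0 <= x <= 1 ->
       0 <= y <= 1 -> `|x - y| < d -> `|x `^ s - y `^ s| <= e.
Proof.
move=> hs e e0.
suff [d d0 h] : exists2 d, 0 < d & forall x y, 0 <= x <= 1 ->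
     0 <= y <= x -> x - y < d -> x `^ s - y `^ s <= e.
  exists d => // x y; have [yx|/ltW xy] := leP y x => x1 y1 xyd.
    move: xyd; rewrite ger0_norm ?subr_ge0 // => xyd.
    rewrite ger0_norm; first by apply: h => //; rewrite (andP y1).1.
    rewrite subr_ge0 ge0_ler_powR ?nnegrE ?(andP x1).1 ?(andP y1).1 //.
    by case: hs => [->|]; lra.
  move: xyd; rewrite distrC ger0_norm ?subr_ge0 // => xyd.
  rewrite distrC ger0_norm; first by apply: h => //; rewrite (andP x1).1.
  rewrite subr_ge0 ge0_ler_powR ?nnegrE ?(andP x1).1 ?(andP y1).1 //.
  by case: hs => [->|]; lra.
case: hs => [->|s1].
  (* For [0 <= v <= u], [(u - v) ^+ 2 <= u ^+ 2 - v ^+ 2]. *)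
  exists (e ^+ 2); first by rewrite exprn_gt0.
  move=> x y /andP[x0 x1] /andP[y0 yx] xyd.
  rewrite !powR12_sqrt // -ler_sqr ?nnegrE ?subr_ge0 ?ler_sqrt ?(ltW e0) //.
  have := sqr_sqrtr x0; have := sqr_sqrtr y0.
  have : Num.sqrt y <= Num.sqrt x by rewrite ler_sqrt.
  have := sqrtr_ge0 y.
  set u := Num.sqrt x; set v := Num.sqrt y => v0 uv v2 u2.
  nra.
(* The tangent at a point of the unit interval has slope at most [s]. *)
exists (e / s); first by rewrite divr_gt0 //; lra.
move=> x y /andP[x0 x1] /andP[y0 yx]; rewrite ltr_pdivlMr; last by lra.
move=> xy.
move: x0; rewrite le_eqVlt => /predU1P[x0|x0].
  have y0' : y = x by lra.
  by rewrite y0' subrr ltW.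
have := powR_tangent s1 x0 y0.
have : x `^ (s - 1) <= 1.
  have := @ge0_ler_powR R (s - 1) _ x 1; rewrite powR1; apply;
    rewrite ?nnegrE //; lra.
have := powR_ge0 x (s - 1); set z := x `^ (s - 1) => z0 z1 h.
have : s * (x - y) * z <= s * (x - y) * 1 by rewrite ler_wpM2l // mulr_ge0; lra.
lra.
Qed.

Lemma powR_approx s M : s = 2^-1 \/ 1 <= s -> 0 < M ->
  exists p_ : nat -> {poly R}, forall e, 0 < e ->
    exists N, forall n, (N <= n)%N ->
      forall t, 0 <= t <= M -> `|(p_ n).[t] - t `^ s| < e.
Proof.
move=> hs M0.
have s0 : 0 < s by case: hs => [->|]; lra.
have Ms : 0 < M `^ s by rewrite powR_gt0.
have ex n : exists p : {poly R}, forall t, 0 <= t <= M ->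
    `|p.[t] - t `^ s| <= n.+1%:R^-1.
  have [||p hp] := @weierstrass R (fun x => x `^ s) 1 (powR_unif_cont hs) _
      (n.+1%:R^-1 / M `^ s).
  - move=> x /andP[x0 x1]; rewrite ger0_norm; last exact: powR_ge0.
    by have := @ge0_ler_powR R s _ x 1; rewrite powR1; apply;
      rewrite ?nnegrE // ltW.
  - by rewrite divr_gt0 // invr_gt0.
  (* Rescaling from the unit interval to [[0, M]] multiplies the error by the factor that was
     divided out above. *)
  exists (M `^ s *: (p \Po (M^-1 *: 'X))) => t /andP[t0 tM].
  rewrite !hornerE horner_comp !hornerE mulrC.
  have -> : t `^ s = (t / M) `^ s * M `^ s.
    by rewrite -powRM ?divr_ge0 ?(ltW M0) // mulfVK // gt_eqF.
  rewrite -mulrBl normrM (gtr0_norm Ms) -ler_pdivlMr // mulrC; apply: hp.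
  by rewrite divr_ge0 ?(ltW M0) //= ler_pdivrMr // mul1r.
exists (fun n => projT1 (cid (ex n))) => e /archi_inv[N hN];
  exists N => n Nn t tM.
by case: cid => p /= hp; apply: le_lt_trans (hp t tM) (hN n Nn).
Qed.
End PowR.

(** * Powers of positive operators, the modulus, and Hoelder-McCarthy *)

Section OpAbs.
Context {R : realType} {H : hilbertType R}.
Implicit Types (A B C T S : H -> H) (u v w k : H) (s e : R).

(** Testing at ['i *: u] recovers the imaginary parts. *)
Lemma symmetric_selfadj S : linear S -> symmetric_op S -> selfadj S.
Proof.
move=> lS sS u v; have := sS u v; have := sS ('i *: u) v.
rewrite /ip (linZ lS) !innerZl.
case: (inner (S u) v) => x y; case: (inner u (S v)) => x' y' /=.
by rewrite !mul0r !mul1r !sub0r => /oppr_inj -> ->.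
Qed.

Lemma fcalc_symmetric f T S : bounded_op T -> selfadj T ->
  is_fcalc f T S -> symmetric_op S.
Proof.
move=> bT sT /is_fcalcP[p_ [_ pS]] u v; apply/eqP; rewrite -subr_eq0 -normr_le0.
apply/ler_addgt0Pr => e e0; rewrite add0r.
have K0 : 0 < 2 * nm u * nm v + 1.
  by rewrite ltr_wpDl // !mulr_ge0 ?nm_ge0.
have [N /(_ N (leqnn N)) hN] := pS _ (divr_gt0 e0 K0).
have -> : ip (S u) v - ip u (S v) = ip (horner_op (p_ N) T v - S v) u
     - ip (horner_op (p_ N) T u - S u) v.
  by rewrite !ipBl (horner_op_sym bT sT _ v) !(ipC _ u) (ipC v); lra.
apply: le_trans (ler_normB _ _) _.
apply: le_trans (lerD (ip_CS _ _) (ip_CS _ _)) _.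
apply: le_trans (lerD (ler_wpM2r (nm_ge0 u) (hN v))
  (ler_wpM2r (nm_ge0 v) (hN u))) _.
apply: (@le_trans _ _ (e / (2 * nm u * nm v + 1) * (2 * nm u * nm v + 1))).
  have := divr_gt0 e0 K0; move: (e / _) => x x0.
  by rewrite mulrDr; lra.
by rewrite mulfVK // gt_eqF.
Qed.

(** The real spectrum lies in [[0, M]], where polynomials approximate the power uniformly; existence
    makes [xget] return a genuine functional calculus instead of its default. *)
Lemma op_powRP T s : bounded_op T -> selfadj T -> (forall u, 0 <= ip (T u) u) ->
    s = 2^-1 \/ 1 <= s ->
  bounded_op (op_powR T s) /\ is_fcalc (fun t => t `^ s) T (op_powR T s).
Proof.
move=> bT sT T0 hs.
apply: (@xgetPex _ _ [set S | bounded_op S /\ is_fcalc _ T S]).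
have [lT [M M0 TM]] := (bounded_opP T).1 bT.
have [p_ hp] := powR_approx hs M0.
apply: (is_fcalc_exists bT sT (p_ := p_)) => e /hp[N hN]; exists N => n Nn t st.
apply: hN => //; apply: real_spectrum_itv st => // u.
exact: le_trans (ler_norm _) (ip_bounded_le u TM).
Qed.

(** The tangent to the power [s] at [x = nm (B k) ^+ 2], taken at [t ^+ 2], is a polynomial [q]
    lying below the power [2 * s] of [t]. Since [ip (B (B k)) k = x], the linear term of its form
    vanishes at [k]. *)
Lemma hoelder_mccarthy B C s k : bounded_op B -> selfadj B ->
    (forall u, 0 <= ip (B u) u) -> 1 <= s -> nm k = 1 ->
    is_fcalc (fun t => t `^ (2 * s)) B C ->
  nm (B k) `^ (2 * s) <= ip (C k) k.
Proof.
move=> bB sB B0 s1 k1 hC.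
have [lB [M M0 BM]] := (bounded_opP B).1 bB.
have spec0 t : real_spectrum B t -> 0 <= t.
  move=> st; suff /andP[] : 0 <= t <= M by [].
  apply: real_spectrum_itv st => // u;
    exact: le_trans (ler_norm _) (ip_bounded_le u BM).
have [Bk0|Bk0] := eqVneq (nm (B k)) 0.
  rewrite Bk0 powR0; last by rewrite gt_eqF //; lra.
  have := is_fcalc_ge (q := 0) bB sB hC _ k.
  rewrite (horner_opC B 0) ipZl mul0r; apply => t _.
  by rewrite horner0 powR_ge0.
pose x := nm (B k) ^+ 2.
have x0 : 0 < x by rewrite exprn_gt0 // lt_def Bk0 nm_ge0.
have xs : nm (B k) `^ (2 * s) = x `^ s by rewrite powRrM powR_mulrn // nm_ge0.
pose q := (x `^ s)%:P + (s * x `^ (s - 1)) *: ('X * 'X - x%:P).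
have := is_fcalc_ge (q := q) bB sB hC _ k.
rewrite horner_opD // horner_opC // horner_opZ // horner_opB //
  horner_opC // horner_opM // !horner_opX //.
rewrite ipDl !ipZl ipBl ipZl -(sqr_nm k) k1 expr1n !mulr1.
rewrite (selfadj_symmetric sB) -sqr_nm subrr mulr0 addr0 xs;
  apply => t /spec0 t0.
by rewrite !hornerE -expr2 powRrM powR_mulrn // powR_tangent // sqr_ge0.
Qed.

Section Abs.
Variable A : H -> H.
Hypothesis bA : bounded_op A.
Let T := adjoint A \o A : H -> H.

Let bT : bounded_op T.
Proof. by apply: bounded_op_comp => //; exact: bounded_op_adjoint. Qed.

Let innerT u v : inner (T u) v = inner (A u) (A v).
Proof. by rewrite innerC -adjointP // -innerC. Qed.

Let sT : selfadj T.
Proof. by move=> u v; rewrite innerT -adjointP. Qed.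

Let ipT u : ip (T u) u = nm (A u) ^+ 2.
Proof. by rewrite sqr_nm /ip innerT. Qed.

Let T0 u : 0 <= ip (T u) u. Proof. by rewrite ipT sqr_ge0. Qed.

Let absP := op_powRP bT sT T0 (or_introl (erefl _)).

Lemma op_abs_bounded : bounded_op (op_abs A).
Proof. exact: absP.1. Qed.

Lemma op_abs_selfadj : selfadj (op_abs A).
Proof. by apply: symmetric_selfadj;
  [exact: absP.1.1 | exact: fcalc_symmetric absP.2]. Qed.

Lemma op_abs_ge0 u : 0 <= ip (op_abs A u) u.
Proof.
have := is_fcalc_ge (q := 0) bT sT absP.2 _ u.
rewrite (horner_opC T 0) ipZl mul0r; apply => t _.
by rewrite horner0 powR_ge0.
Qed.

(** On the spectrum of [T], the square of [p_ m] is at least [t] up to [2 * d * (M + 1)]. Hence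
    [ip (T u) u], which is [nm (A u) ^+ 2], is at most [nm (horner_op (p_ m) T u) ^+ 2] up to a
    small error, and [horner_op (p_ m) T] tends to [op_abs A]. *)
Lemma nm_op_abs u : nm (A u) <= nm (op_abs A u).
Proof.
have [lT [M M0 TM]] := (bounded_opP T).1 bT.
rewrite -ler_sqr ?nnegrE ?nm_ge0 //.
have /is_fcalcP[p_ [pf pS]] := absP.2.
apply/ler_addgt0Pr => e e0.
set b := nm (op_abs A u); set n := nm u.
have b0 : 0 <= b := nm_ge0 _.
have n0 : 0 <= n := nm_ge0 _.
(* For [d <= 1], [d * K] covers both the expansion of [(b + d * n) ^+ 2] and the spectral error. *)
pose K := 2 * b * n + n ^+ 2 + 2 * (M + 1) * n ^+ 2 + 1.
have K0 : 0 < K by rewrite ltr_wpDl //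
  !addr_ge0 ?mulr_ge0 ?sqr_ge0 ?addr_ge0 // ltW.
pose d := Num.min 1 (e / K).
have d0 : 0 < d by rewrite lt_min ltr01 divr_gt0.
have d1 : d <= 1 by rewrite ge_min lexx.
have dK : d * K <= e by rewrite -ler_pdivlMr // ge_min lexx orbT.
have [N1 h1] := pf d d0; have [N2 h2] := pS d d0.
pose m := maxn N1 N2.
have := h1 m (leq_maxl _ _); have {h1 h2} := h2 m (leq_maxr _ _) u => h2 h1.
have : 0 <= ip (horner_op (p_ m * p_ m + (2 * d * (M + 1))%:P - 'X) T u) u.
  apply: horner_op_ge0 => // t st; have := h1 t st.
  have /andP[t0 tM] : 0 <= t <= M.
    apply: real_spectrum_itv st => // v.
    exact: le_trans (ler_norm _) (ip_bounded_le v TM).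
  rewrite powR12_sqrt // !hornerE ltr_norml => /andP[].
  have := sqr_sqrtr t0; have := sqrtr_ge0 t.
  move: (p_ m).[t] (Num.sqrt t) => x y y0 yt a1 a2.
  have yM : y <= M + 1 by nra.
  have : 0 <= (x - y) ^+ 2 := sqr_ge0 _.
  nra.
rewrite horner_opB // horner_opX // horner_opD // horner_opM //
  horner_opC // ipBl ipDl ipZl -sqr_nm ipT.
rewrite (horner_op_sym bT sT) -sqr_nm -/n.
have : nm (horner_op (p_ m) T u) <= b + d * n.
  rewrite -[horner_op _ _ _](subrK (op_abs A u)) addrC.
  by apply: le_trans (nmD _ _) _; rewrite lerD.
have := nm_ge0 (horner_op (p_ m) T u).
move: (nm (horner_op _ _ _)) (nm (A u)) => x y x0 xb xy.
have : x ^+ 2 <= (b + d * n) ^+ 2.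
  by rewrite ler_sqr ?nnegrE // addr_ge0 ?mulr_ge0 // ltW.
have : d * d * n ^+ 2 <= d * 1 * n ^+ 2.
  by rewrite ler_wpM2r ?sqr_ge0 // ler_wpM2l // ltW.
move: dK; rewrite /K => dK h3 h4.
have h5 : (b + d * n) ^+ 2 = b ^+ 2 + 2 * d * b * n + d * d * n ^+ 2 by ring.
rewrite h5 in h4; move: dK xy h3 h4; rewrite !mulrDr !mulrDl; lra.
Qed.

Lemma op_powR_abs_bounded s : 1 <= s -> bounded_op (op_powR (op_abs A) s).
Proof.
move=> s1; have [] // := @op_powRP (op_abs A) s op_abs_bounded op_abs_selfadj
  op_abs_ge0.
by right.
Qed.

Lemma nm_powR_le s k : 1 <= s -> nm k = 1 ->
  nm (A k) `^ (2 * s) <= ip (op_powR (op_abs A) (2 * s) k) k.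
Proof.
move=> s1 k1.
have [|_] := @op_powRP (op_abs A) (2 * s) op_abs_bounded op_abs_selfadj
  op_abs_ge0.
  by right; lra.
move=> /(hoelder_mccarthy op_abs_bounded op_abs_selfadj op_abs_ge0 s1 k1).
apply: le_trans; rewrite ge0_ler_powR ?nnegrE ?nm_ge0 ?nm_op_abs //; lra.
Qed.
End Abs.
End OpAbs.

(** * Scalar convexity and Young inequalities *)

Section RealIneq.
Context {R : realType}.
Implicit Types (x y a b p q r s t : R).

(** The weighted sum of the tangent inequalities at [c], whose linear terms cancel. *)
Lemma powR_convex2 s t x y : 1 <= s -> 0 <= t <= 1 -> 0 <= x -> 0 <= y ->
  (t * x + (1 - t) * y) `^ s <= t * x `^ s + (1 - t) * y `^ s.
Proof.
move=> s1 /andP[t0 t1] x0 y0; set c := t * x + (1 - t) * y.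
have t1' : 0 <= 1 - t by rewrite subr_ge0.
have : 0 <= c by rewrite addr_ge0 ?mulr_ge0.
rewrite le_eqVlt => /predU1P[<-|c0].
  by rewrite powR0 ?addr_ge0 ?mulr_ge0 ?powR_ge0 //; rewrite gt_eqF; lra.
have := ler_wpM2l t0 (powR_tangent s1 c0 x0).
have := ler_wpM2l t1' (powR_tangent s1 c0 y0).
set k := s * c `^ (s - 1) => h1 h2.
have := lerD h2 h1; congr (_ <= _).
by rewrite /c; ring.
Qed.

(** The Young bounds for [a * b] and for its power [r - 1] are multiplied out; the diagonal terms
    merge into the powers [p * r] and [q * r]. *)
Lemma young_powR_mul a b p q r : 0 <= a -> 0 <= b -> 0 < p -> 0 < q ->
    p^-1 + q^-1 = 1 -> 1 < r ->
  (a * b) `^ r <= a `^ (p * r) / p ^+ 2 + b `^ (q * r) / q ^+ 2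
    + (a `^ (p * (r - 1)) * b `^ q + a `^ p * b `^ (q * (r - 1))) / (p * q).
Proof.
move=> a0 b0 p0 q0 pq r1.
have r0 : 0 < r by lra.
have r1' : 0 < r - 1 by lra.
have ab0 : 0 <= a * b by rewrite mulr_ge0.
have split c x : 0 <= c -> 0 < x -> c `^ (x * r) = c `^ x * c `^ (x * (r - 1)).
  move=> c0 x0; rewrite -powRD; first by congr (_ `^ _); ring.
  by rewrite gt_eqF // addr_gt0 ?mulr_gt0.
rewrite -(mulr_powRB1 ab0 r0).
have h1 : a * b <= a `^ p / p + b `^ q / q by apply: conjugate_powR.
have h2 : (a * b) `^ (r - 1) <= a `^ (p * (r - 1)) / p + b `^ (q * (r - 1)) / q.
  rewrite powRM // (mulrC p) (mulrC q) !powRrM.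
  by apply: conjugate_powR; rewrite ?powR_ge0.
apply: le_trans (ler_pM _ _ h1 h2) _; rewrite ?powR_ge0 //.
rewrite !split //; move: (a `^ _) (a `^ _) (b `^ _) (b `^ _) => A1 A2 B1 B2.
by rewrite le_eqVlt; apply/orP; left; apply/eqP; field; rewrite !lt0r_neq0.
Qed.
End RealIneq.

(** * Moduli of inner products and Buzano's inequality *)

Section Berezin.
Context {R : realType} {H : hilbertType R}.
Implicit Types (u v k : H) (T : H -> H).

Definition cabs (z : R[i]) : R := complex.Re `|z|.

Lemma cabsE (z : R[i]) : `|z| = (cabs z)%:C.
Proof. by rewrite RRe_real // ger0_real. Qed.

Lemma cabs_ge0 z : 0 <= cabs z.
Proof. by rewrite -ler0c -cabsE. Qed.

Lemma cabs_inner u v : cabs (inner u v) <= nm u * nm v.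
Proof. by rewrite -lecR rmorphM /= -!norm_nm -cabsE inner_CS. Qed.

Lemma Re_le_cabs z : complex.Re z <= cabs z.
Proof.
rewrite -lecR -cabsE; apply: le_trans (normc_ge_Re z).
by rewrite lecR ler_norm.
Qed.

(* The reflection [2 <a, k> k - a] of [a] has the same norm as [a]. *)
Lemma buzano u v k : nm k = 1 ->
  2 * (cabs (inner u k) * cabs (inner k v)) <= nm u * nm v + cabs (inner u v).
Proof.
move=> k1; set z := inner u k.
have kk : inner k k = 1 by rewrite -sqr_norm_inner norm_nm k1 expr1n.
have refl : nm ((2 * z) *: k - u) = nm u.
  apply/eqP; rewrite -(@eqrXn2 _ 2) ?nm_ge0 // !sqr_nm /ip.
  rewrite linearBl /= !linearBr /= !innerZl !innerZr kk -/z (innerC k u) -/z.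
  rewrite rmorphM rmorph_nat; apply/eqP; congr complex.Re; ring.
rewrite -refl -lecR rmorphD !rmorphM /= -!cabsE -!norm_nm -normrM.
rewrite -[2%:C]ger0_norm -?normrM ?ler0c //.
have -> : 2%:C * (z * inner k v) = inner ((2 * z) *: k - u) v + inner u v.
  by rewrite linearBl /= innerZl subrK mulrA rmorph_nat.
by apply: le_trans (ler_normD _ _) _; rewrite lerD // inner_CS.
Qed.
End Berezin.

(** * Passage between values at normalized kernels and Berezin suprema *)

Section BerezinNorm.
Context {R : realType} {X : Type} {H : rkhsType R X}.
Implicit Types (T : H -> H) (x : X).
Hypothesis ker_neq0 : forall x, repr_kernel x != 0 :> H.

Let kh x : H := nrepr_kernel x.

Lemma nm_nrepr x : nm (kh x) = 1.
Proof.
rewrite /nm /kh /nrepr_kernel normrZ normfV normr_id mulVf // normr_eq0.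
exact: ker_neq0.
Qed.

(** Boundedness of [T] on unit kernels bounds the set, so its [sup] is a least upper bound and not a
    default value. *)
Lemma ber_ge T x : bounded_op T -> cabs (inner (T (kh x)) (kh x)) <= ber T.
Proof.
move=> /bounded_opP[_ [M M0 TM]]; apply: ub_le_sup; last by exists x.
exists M => _ [y _ <-]; apply: le_trans (cabs_inner _ _) _.
by rewrite nm_nrepr mulr1 (le_trans (TM _)) // nm_nrepr mulr1.
Qed.

Lemma ber_norm_ge T x : bounded_op T -> ip (T (kh x)) (kh x) <= ber_norm T.
Proof.
move=> /bounded_opP[_ [M M0 TM]]; apply: le_trans (Re_le_cabs _) _.
(* The diagonal pair is among those of the Berezin norm. *)
apply: ub_le_sup; last by exists (x, x).
exists M => _ [y _ <-]; apply: le_trans (cabs_inner _ _) _.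
by rewrite nm_nrepr mulr1 (le_trans (TM _)) // nm_nrepr mulr1.
Qed.

(** The bound passes through the root [s^-1] to reach the supremum itself, and is raised back; a
    point of [X] makes [K] nonnegative and the set nonempty. *)
Lemma ber_powR_le T (s K : R) : [set: X] !=set0 -> bounded_op T -> 0 < s ->
  (forall x, cabs (inner (T (kh x)) (kh x)) `^ s <= K) -> ber T `^ s <= K.
Proof.
move=> [x0 _] bT s0 h.
have K0 : 0 <= K by apply: le_trans (h x0); exact: powR_ge0.
have : ber T <= K `^ s^-1.
  apply: ge_sup; first by exists (cabs (inner (T (kh x0)) (kh x0))), x0.
  move=> _ [x _ <-]; rewrite -/(cabs _).
  have := ge0_ler_powR (r := s^-1) _ _ _ (h x).
  rewrite -powRrM mulfV ?gt_eqF // powRr1 ?cabs_ge0 //; apply.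
  - by rewrite invr_ge0 ltW.
  - by rewrite nnegrE powR_ge0.
  - by rewrite nnegrE.
move=> /(ge0_ler_powR (ltW s0)).
rewrite -powRrM mulVf ?gt_eqF // powRr1 //; apply; rewrite nnegrE ?powR_ge0 //.
by apply: le_trans (ber_ge x0 bT); exact: cabs_ge0.
Qed.

Lemma nm_powR_ber A (s : R) x : bounded_op A -> 1 <= s ->
  nm (A (kh x)) `^ (2 * s) <= ber_norm (op_powR (op_abs A) (2 * s)).
Proof.
move=> bA s1; apply: le_trans (nm_powR_le bA s1 (nm_nrepr x)) _.
by apply: ber_norm_ge; apply: op_powR_abs_bounded => //; lra.
Qed.

(** The square root of [nm_powR_ber], for the mixed terms of [young_powR_mul]. *)
Lemma nm_powR_ber_sqrt A (s : R) x : bounded_op A -> 1 <= s ->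
  nm (A (kh x)) `^ s <= ber_norm (op_powR (op_abs A) (2 * s)) `^ 2^-1.
Proof.
move=> bA s1; have h := nm_powR_ber x bA s1.
have -> : nm (A (kh x)) `^ s = nm (A (kh x)) `^ (2 * s) `^ 2^-1.
  by rewrite -powRrM; congr (_ `^ _); field.
rewrite ge0_ler_powR ?nnegrE ?powR_ge0 ?invr_ge0 //.
by apply: le_trans h; exact: powR_ge0.
Qed.

End BerezinNorm.

Theorem theorem4p1 (R : realType) (X : Type) (H : rkhsType R X)
    (X_nonempty : [set: X] !=set0)
    (repr_kernel_neq0 : forall x : X, repr_kernel x != 0 :> H)
    (A : H -> H) (A_bounded : bounded_op A)
    (p q r zeta : R) (p_ge1 : 1 <= p) (q_ge1 : 1 <= q)
    (conj_pq : p^-1 + q^-1 = 1) (r_ge2 : 2 <= r) (zeta_ge0 : 0 <= zeta) :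
  let absA := op_abs A in
  let absA' := op_abs (adjoint A) in
  ber A `^ (2 * r) <=
    (2 * zeta + 1) / (2 * zeta + 2) *
      (ber_norm (op_powR absA (p * r)) / p ^+ 2
       + ber_norm (op_powR absA' (q * r)) / q ^+ 2
       + (ber_norm (op_powR absA (2 * p * (r - 1))) `^ 2^-1
            * ber_norm (op_powR absA' (2 * q)) `^ 2^-1
          + ber_norm (op_powR absA (2 * p)) `^ 2^-1
            * ber_norm (op_powR absA' (2 * q * (r - 1))) `^ 2^-1)
         / (p * q))
    + ber (A \o A) `^ r / (2 * zeta + 2).
Proof.
cbv zeta; set absA := op_abs A; set absA' := op_abs (adjoint A).
have bA' := bounded_op_adjoint A_bounded.
have bAA := bounded_op_comp A_bounded A_bounded.
have p0 : 0 < p by lra.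
have q0 : 0 < q by lra.
have r0 : 0 < r by lra.
have r1 : 1 < r by lra.
have r1' : 1 <= r by lra.
have z2 : 0 < 2 * zeta + 2 by lra.
apply: (ber_powR_le repr_kernel_neq0 X_nonempty A_bounded);
  first by rewrite mulr_gt0.
move=> x; set k : H := nrepr_kernel x; set z := cabs _.
set a := nm (A k); set b := nm (adjoint A k).
have k1 : nm k = 1 by exact: nm_nrepr.
have a0 : 0 <= a := nm_ge0 _.
have b0 : 0 <= b := nm_ge0 _.
have z0 : 0 <= z := cabs_ge0 _.
pose c := cabs (inner (A (A k)) k).
have c0 : 0 <= c := cabs_ge0 _.
have kA : inner k (adjoint A k) = inner (A k) k by rewrite adjointP.
(* One factor [z] is estimated through [A k], the other through [adjoint A k]. *)
have z_ab : z ^+ 2 <= a * b.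
  rewrite expr2; apply: ler_pM => //.
    by apply: le_trans (cabs_inner _ _) _; rewrite k1 mulr1.
  by rewrite /z -kA; apply: le_trans (cabs_inner _ _) _; rewrite k1 mul1r.
(* Buzano for [A k] and [adjoint A k], whose inner product is [inner (A (A k)) k]. *)
have z_buz : 2 * z ^+ 2 <= a * b + c.
  have := buzano (A k) (adjoint A k) k1.
  by rewrite kA -adjointP.
pose t := (2 * zeta + 1) / (2 * zeta + 2).
have tE : 1 - t = (2 * zeta + 2)^-1 by rewrite /t; field; exact: lt0r_neq0.
have t01 : 0 <= t <= 1.
  by rewrite divr_ge0 /= ?ler_pdivrMr ?mul1r ?ltW //; lra.
(* This is [z_buz] plus [2 * zeta] times [z_ab], divided by [2 * zeta + 2]. *)
have zt : z ^+ 2 <= t * (a * b) + (1 - t) * c.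
  have -> : t * (a * b) + (1 - t) * c =
     ((2 * zeta + 1) * (a * b) + c) / (2 * zeta + 2).
    by rewrite tE /t; field; exact: lt0r_neq0.
  rewrite ler_pdivlMr //.
  have := ler_wpM2l zeta_ge0 z_ab; lra.
have -> : z `^ (2 * r) = (z ^+ 2) `^ r by rewrite powRrM powR_mulrn.
have ab0 : 0 <= a * b by rewrite mulr_ge0.
case/andP: (t01) => t0 t1.
have t1' : 0 <= 1 - t by rewrite subr_ge0.
apply: (@le_trans _ _ ((t * (a * b) + (1 - t) * c) `^ r)).
  by rewrite ge0_ler_powR ?nnegrE ?sqr_ge0 ?addr_ge0 ?(mulr_ge0 t0 ab0)
    ?(mulr_ge0 t1' c0) ?(ltW r0).
apply: le_trans (powR_convex2 r1' t01 ab0 c0) _.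
rewrite -/t tE [_^-1 * _]mulrC.
apply: lerD; last first.
  rewrite ler_wpM2r ?invr_ge0 ?(ltW z2) // ge0_ler_powR ?nnegrE ?(ltW r0) //.
    by apply: le_trans (ber_ge repr_kernel_neq0 x bAA); exact: cabs_ge0.
  exact: (ber_ge repr_kernel_neq0 x bAA).
rewrite ler_wpM2l //; apply: le_trans (young_powR_mul a0 b0 p0 q0 conj_pq r1) _.
(* Hoelder-McCarthy asks that half of each exponent be at least [1]; this follows from [2 <= r],
   [1 <= p] and [1 <= q]. *)
have pr : p * r = 2 * (p * r / 2) by field.
have qr : q * r = 2 * (q * r / 2) by field.
have pr1 : 1 <= p * r / 2 by nra.
have qr1 : 1 <= q * r / 2 by nra.
have pr2 : 1 <= p * (r - 1) by nra.
have qr2 : 1 <= q * (r - 1) by nra.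
have a_pr : a `^ (p * r) <= ber_norm (op_powR absA (p * r)).
  by rewrite pr; exact: nm_powR_ber.
have b_qr : b `^ (q * r) <= ber_norm (op_powR absA' (q * r)).
  by rewrite qr; exact: nm_powR_ber.
rewrite -!(mulrA 2); apply: lerD; last first.
  rewrite ler_wpM2r ?invr_ge0 ?mulr_ge0 ?(ltW p0) ?(ltW q0) //.
  by apply: lerD; apply: ler_pM; rewrite ?powR_ge0 // nm_powR_ber_sqrt.
apply: lerD; [apply: ler_wpM2r a_pr | apply: ler_wpM2r b_qr].
  by rewrite invr_ge0 sqr_ge0.
by rewrite invr_ge0 sqr_ge0.
Qed.
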